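(* Let $\{X_n,n\geq1\}$ be a $\varphi$-mixing sequence of random variables with common marginal distribution function $F$, whose mixing coefficients satisfy $\sum_{n=1}^\infty\varphi^{1/2}(n)<\infty$. Fix $p\in(0,1)$, let $\xi_p=\inf\{x:F(x)\geq p\}$ and $\xi_{p,n}=\inf\{x:F_n(x)\geq p\}$. Assume that $F$ possesses a positive continuous density $f$ in a neighborhood $\mathscr{N}_p$ of $\xi_p$ such that $0<\sup\{f(x):x\in\mathscr{N}_p\}<\infty$, and that $f'$ exists and is bounded in some neighborhood of $\xi_p$. Then with probability 1, $$\xi_{p,n}=\xi_p-\frac{F_n(\xi_p)-p}{f(\xi_p)}+O\left(\frac{(\log n)^{1/2}}{n^{1/2}}\right),\quad n\to\infty.$$
   Context: All random variables are defined on a probability space $(\Omega,\mathcal{F},P)$. $F_n(x)=\frac1n\sum_{i=1}^n I(X_i\leq x)$ is the empirical distribution function of $X_1,\dots,X_n$. For $n\leq m$ let $\mathcal{F}_n^m=\sigma(X_i,n\leq i\leq m)$. For sub-$\sigma$-algebras $\mathcal{B},\mathcal{R}$ let $\varphi(\mathcal{B},\mathcal{R})=\sup_{A\in\mathcal{B},B\in\mathcal{R},P(A)>0}|P(B\mid A)-P(B)|$, and the mixing coefficients are $\varphi(n)=\sup_{k\geq1}\varphi(\mathcal{F}_1^k,\mathcal{F}_{k+n}^\infty)$. The sequence is called $\varphi$-mixing if $\varphi(n)\downarrow0$ as $n\to\infty$. *)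

(* Defs.v *)
From HB Require Import structures.
From mathcomp Require Import all_boot all_order all_algebra.
From mathcomp Require Import all_classical all_reals all_analysis.
Set Implicit Arguments. Unset Strict Implicit. Unset Printing Implicit Defensive.
Import Order.TTheory GRing.Theory Num.Theory.
Import numFieldNormedType.Exports.
Local Open Scope classical_set_scope.
Local Open Scope ring_scope.

Definition gen_sigma d (T : measurableType d) (R : realType)
  (X : nat -> T -> R) (I : set nat) : set (set T) :=
  <<s [set A | exists2 i, I i & exists2 B : set R, measurable B & A = X i @^-1` B] >>.

Definition sigmaF d (T : measurableType d) (R : realType)
  (X : nat -> T -> R) (n m : nat) : set (set T) :=
  gen_sigma X [set i | (n <= i <= m)%N].

Definition sigmaF_inf d (T : measurableType d) (R : realType)
  (X : nat -> T -> R) (n : nat) : set (set T) :=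
  gen_sigma X [set i | (n <= i)%N].

Definition phi_sigma d (T : measurableType d) (R : realType)
  (P : probability T R) (G H : set (set T)) : R :=
  sup [set r : R | exists A, exists B, [/\ G A, H B, (0 < P A)%E &
        r = `| fine (P (B `&` A)) / fine (P A) - fine (P B) | ] ].

Definition phi_mix d (T : measurableType d) (R : realType)
  (P : probability T R) (X : nat -> T -> R) (n : nat) : R :=
  sup [set r : R | exists2 k : nat, (1 <= k)%N &
        r = phi_sigma P (sigmaF X 1 k) (sigmaF_inf X (k + n))].

Definition empF (T : Type) (R : realType) (X : nat -> T -> R) (n : nat)
  (w : T) (x : R) : R :=
  n%:R^-1 * (\sum_(1 <= i < n.+1) (if X i w <= x then 1 else 0)).

Definition quantile (R : realType) (G : R -> R) (p : R) : R :=
  inf [set x : R | p <= G x].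

(* Main.v *)
(** The remainder [O (sqrt (ln n / n))] is large enough to absorb both
    [quantile (empF n) p - xi] and [empF n xi - p], so each of the two is
    bounded separately, where [xi = quantile F p].  For a Borel set [B] the
    number of [i <= n] with [X i \in B] satisfies a Hoeffding-Azuma inequality:
    conditionally on the past, revealing one more indicator changes the expected
    final count by at most [K = 1 + 2 \sum_k phi k], which is finite because
    [phi k <= sqrt (phi k)].  Hence a deviation of order [sqrt (n ln n)] from
    the mean has probability at most [n^-2], and Borel-Cantelli applies to the
    four events [empF n xi >= p + C sqrt (ln n / n)], [empF n xi <= p - ...],
    [empF n (xi + h_n) < p] and [empF n (xi - h_n) >= p] with [h_n] a multiple
    of [sqrt (ln n / n)]; positivity of the density at [xi] makes
    [F (xi +- h_n)] differ from [p] by at least a multiple of [h_n]. *)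
Require Import Defs.
From HB Require Import structures.
From mathcomp Require Import all_boot all_order all_algebra.
From mathcomp Require Import all_classical all_reals all_analysis.
From mathcomp Require Import measurable_realfun ring lra.
Set Implicit Arguments. Unset Strict Implicit. Unset Printing Implicit Defensive.
Import Order.TTheory GRing.Theory Num.Theory.
Import numFieldNormedType.Exports.
Local Open Scope classical_set_scope.
Local Open Scope ring_scope.

(** * Exponential inequalities for a single revealed indicator *)

Lemma expR_le_quadratic (R : realType) (x : R) :
  x <= 2^-1 -> expR x <= 1 + x + 2 * x ^+ 2.
Proof.
move=> xle; have x1 : 0 < 1 - x by lra.
have xN : 1 - x <= (expR x)^-1 by rewrite -expRN; exact: expR_ge1Dx.
apply: (@le_trans _ _ (1 - x)^-1).
  by rewrite -[leLHS]invrK lef_pV2// posrE invr_gt0 expR_gt0.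
rewrite -[leLHS]mul1r ler_pdivrMr//.
(* This product equals [(1 - x) * (1 + x + 2 * x ^+ 2) - 1]. *)
have : 0 <= x ^+ 2 * (1 - 2 * x) by rewrite mulr_ge0 ?sqr_ge0//; lra.
nra.
Qed.

(** One step of the martingale bound: around the mean, the deviations [(1 - q) * (u - v)] and
    [- q * (u - v)] cancel to first order under the weights [q] and [1 - q], so only the quadratic
    term of the exponential survives. *)
Lemma two_point_mgf_le (R : realType) (q u v K lam : R) :
  0 <= q <= 1 -> `|u - v| <= K -> 0 <= lam -> lam * K <= 2^-1 ->
  q * expR (lam * u) + (1 - q) * expR (lam * v) <=
  expR (lam * (q * u + (1 - q) * v) + 2 * (lam * K) ^+ 2).
Proof.
move=> /andP[q0 q1] uvK lam0 lamK; set e := q * u + (1 - q) * v.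
have K0 : 0 <= K by apply: le_trans uvK.
have quad s : `|s| <= 1 -> expR (lam * (s * (u - v))) <=
    1 + lam * (s * (u - v)) + 2 * (lam * K) ^+ 2.
  move=> s1; have xK : `|lam * (s * (u - v))| <= lam * K.
    rewrite normrM (ger0_norm lam0) ler_wpM2l// normrM.
    by rewrite -[leRHS]mul1r ler_pM.
  apply: le_trans (expR_le_quadratic _) _.
    by apply: le_trans (ler_norm _) (le_trans xK _).
  rewrite lerD2l ler_wpM2l// -real_normK ?num_real//.
  by rewrite lerXn2r ?nnegrE// mulr_ge0.
have -> : lam * u = lam * e + lam * ((1 - q) * (u - v)) by rewrite /e; ring.
have -> : lam * v = lam * e + lam * (- q * (u - v)) by rewrite /e; ring.
rewrite !expRD.
apply: (@le_trans _ _ (expR (lam * e) * (1 + 2 * (lam * K) ^+ 2))); last first.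
  by rewrite ler_wpM2l ?expR_ge0// expR_ge1Dx.
rewrite !(mulrCA _ (expR (lam * e))) -mulrDr ler_wpM2l ?expR_ge0//.
have h1 : `|1 - q| <= 1 by rewrite ger0_norm; lra.
have h2 : `|- q| <= 1 by rewrite normrN ger0_norm; lra.
have q1' : 0 <= 1 - q by lra.
have := lerD (ler_wpM2l q0 (quad _ h1)) (ler_wpM2l q1' (quad _ h2)).
by move/le_trans; apply; rewrite le_eqVlt; apply/orP; left; apply/eqP; ring.
Qed.

(** * Mixing coefficients and the exponential tail bound for counts *)

Section phi_mixing.
Context (d : measure_display) (T : measurableType d) (R : realType).
Variables (P : probability T R) (X : nat -> T -> R).
Hypothesis mX : forall i, measurable_fun setT (X i).

Let pr (A : set T) : R := fine (P A).

Let pr_ge0 A : 0 <= pr A.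
Proof. exact/fine_ge0/measure_ge0. Qed.

Let prE A : measurable A -> P A = (pr A)%:E.
Proof. by move=> mA; rewrite fineK// fin_num_measure. Qed.

Let pr_le1 A : measurable A -> pr A <= 1.
Proof. by move=> mA; rewrite -lee_fin -prE// probability_le1. Qed.

Let pr_le A B : measurable A -> measurable B -> A `<=` B -> pr A <= pr B.
Proof.
move=> mA mB AB; rewrite -lee_fin -!prE//.
by apply: le_measure => //; rewrite inE.
Qed.

Let prI A B : measurable A -> measurable B ->
  pr A = pr (A `&` B) + pr (A `&` ~` B).
Proof.
move=> mA mB; rewrite -[in LHS](setIT A) -(setUv B) setIUr.
have mB' : measurable (~` B) by exact: measurableC.
rewrite /pr measureU ?fineD ?fin_num_measure//; try exact: measurableI.
by rewrite setIACA setICr setI0.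
Qed.

Lemma gen_sigma_measurable (I : set nat) (A : set T) :
  gen_sigma X I A -> measurable A.
Proof.
apply: smallest_sub; first exact: sigma_algebra_measurable.
by move=> _ [i Ii [B mB ->]]; rewrite -[_ @^-1` _]setTI; exact: mX.
Qed.

Lemma gen_sigma_preimage (I : set nat) (i : nat) (B : set R) :
  I i -> measurable B -> gen_sigma X I (X i @^-1` B).
Proof. by move=> Ii mB; apply: sub_sigma_algebra; exists i => //; exists B. Qed.

Lemma gen_sigmaI (I : set nat) (A B : set T) :
  gen_sigma X I A -> gen_sigma X I B -> gen_sigma X I (A `&` B).
Proof. exact: (@measurableI _ (g_sigma_algebraType _)). Qed.

Lemma gen_sigmaS (I J : set nat) : I `<=` J -> gen_sigma X I `<=` gen_sigma X J.
Proof.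
move=> IJ; apply: sub_smallest2r => // _ [i Ii [B mB ->]].
by exists i; [exact: IJ|exists B].
Qed.

Let mixing_dev_le1 (I J : set nat) (A B : set T) :
  gen_sigma X I A -> gen_sigma X J B ->
  `|pr (B `&` A) / pr A - pr B| <= 1.
Proof.
move=> /gen_sigma_measurable mA /gen_sigma_measurable mB.
have mBA : measurable (B `&` A) by exact: measurableI.
have h1 : pr (B `&` A) <= pr A by exact: pr_le.
have := pr_ge0 A; have := pr_ge0 B; have := pr_le1 mB.
move=> B1 B0 A0.
have h2 : 0 <= pr (B `&` A) / pr A by rewrite divr_ge0.
have h3 : pr (B `&` A) / pr A <= 1.
  move: A0; rewrite le_eqVlt => /predU1P[<-|A0]; first by rewrite invr0 mulr0.
  by rewrite ler_pdivrMr// mul1r.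
by rewrite ler_norml; apply/andP; split; lra.
Qed.

(** [sup] takes the default value 0 on a set without a supremum, so nonemptiness and boundedness
    must be known before a coefficient can serve as an upper bound. *)
Let phi_sigma_has_sup (I J : set nat) : has_sup
  [set r : R | exists A, exists B, [/\ gen_sigma X I A, gen_sigma X J B,
    (0 < P A)%E & r = `|fine (P (B `&` A)) / fine (P A) - fine (P B)| ] ].
Proof.
have gT (K : set nat) : gen_sigma X K setT.
  exact: (@measurableT _ (g_sigma_algebraType _)).
split.
  exists `|fine (P (setT `&` setT)) / fine (P setT) - fine (P setT)|.
  by exists setT, setT; split => //; rewrite probability_setT.
exists 1 => _ [A [B [gA gB _ ->]]]; exact: mixing_dev_le1 gA gB.
Qed.

Lemma phi_sigma_le1 (I J : set nat) :
  phi_sigma P (gen_sigma X I) (gen_sigma X J) <= 1.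
Proof.
apply: sup_le_ub; first by have [] := phi_sigma_has_sup I J.
by move=> _ [A [B [gA gB _ ->]]]; exact: mixing_dev_le1 gA gB.
Qed.

Let phi_mix_has_sup n : has_sup [set r : R | exists2 k : nat, (1 <= k)%N &
        r = phi_sigma P (sigmaF X 1 k) (sigmaF_inf X (k + n))].
Proof.
split; first by exists (phi_sigma P (sigmaF X 1 1) (sigmaF_inf X (1 + n))), 1%N.
by exists 1 => _ [k k1 ->]; exact: phi_sigma_le1.
Qed.

Lemma phi_mix_le1 n : phi_mix P X n <= 1.
Proof.
apply: sup_le_ub; first by have [] := phi_mix_has_sup n.
by move=> _ [k k1 ->]; exact: phi_sigma_le1.
Qed.

Lemma phi_mix_ub (n k : nat) (A B : set T) : (1 <= k)%N ->
  sigmaF X 1 k A -> sigmaF_inf X (k + n) B -> (0 < P A)%E ->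
  `|fine (P (B `&` A)) / fine (P A) - fine (P B)| <= phi_mix P X n.
Proof.
move=> k1 FA FB PA.
apply: (@le_trans _ _ (phi_sigma P (sigmaF X 1 k) (sigmaF_inf X (k + n)))).
  by apply: sup_upper_bound; [exact: phi_sigma_has_sup|exists A, B].
by apply: sup_upper_bound; [exact: phi_mix_has_sup|exists k].
Qed.

Lemma phi_mix_ge0 n : 0 <= phi_mix P X n.
Proof.
apply: le_trans (@phi_mix_ub n 1 setT setT isT _ _ _) => //.
- exact: (@measurableT _ (g_sigma_algebraType _)).
- exact: (@measurableT _ (g_sigma_algebraType _)).
- by rewrite probability_setT.
Qed.

(** As [phi_mix] lies in [0, 1], it is at most its own square root; the series then bounds all
    partial sums uniformly. *)
Lemma sum_phi_mix_bounded :
  (\sum_(1 <= n <oo) (Num.sqrt (phi_mix P X n))%:E < +oo)%E ->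
  exists S : R, forall r : nat, \sum_(k < r) phi_mix P X k.+1 <= S.
Proof.
move=> Soo; exists (fine (\sum_(1 <= n <oo) (Num.sqrt (phi_mix P X n))%:E)%E).
move=> r; rewrite -lee_fin fineK; last first.
  by rewrite ge0_fin_numE// nneseries_ge0// => n _ _; rewrite lee_fin sqrtr_ge0.
apply: le_trans (nneseries_lim_ge r.+1 _); last first.
  by move=> n _ _; rewrite lee_fin sqrtr_ge0.
rewrite big_add1/= big_mkord sumEFin lee_fin; apply: ler_sum => k _.
have := phi_mix_ge0 k.+1; have := phi_mix_le1 k.+1.
move: (phi_mix _ _ _) => x x1 x0.
rewrite -{1}(sqr_sqrtr x0) expr2 ler_piMr ?sqrtr_ge0//.
by rewrite -sqrtr1 ler_wsqrtr.
Qed.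

Variable B : set R.
Hypothesis mB : measurable B.

Let mXB i : measurable (X i @^-1` B).
Proof. by rewrite -[_ @^-1` _]setTI; exact: mX. Qed.

(** The conditional expectation given [A] of the number of hits of [B] among the indices [i + 1] to
    [i + r]; it is 0 for null [A], since division by 0 gives 0. *)
Let cmean (A : set T) (i r : nat) : R :=
  \sum_(k < r) pr (X (i + k).+1 @^-1` B `&` A) / pr A.

(** The variable of index [i + k + 1] is separated from the past up to [i] by a gap [k + 1], so its
    term costs at most [phi_mix P X k.+1]. *)
Let cmean_dev (A : set T) (i r : nat) : (1 <= i)%N -> sigmaF X 1 i A ->
  0 < pr A ->
  `|cmean A i r - \sum_(k < r) pr (X (i + k).+1 @^-1` B)| <=
  \sum_(k < r) phi_mix P X k.+1.
Proof.
move=> i1 FA A0; rewrite -sumrB; apply: le_trans (ler_norm_sum _ _ _) _.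
apply: ler_sum => k _; apply: (phi_mix_ub i1 FA).
- by apply: gen_sigma_preimage => //=; rewrite addnS.
- by rewrite (prE (gen_sigma_measurable FA)) lte_fin.
Qed.

Let prMdiv (A C : set T) : measurable A -> measurable C ->
  pr A * (pr (C `&` A) / pr A) = pr (C `&` A).
Proof.
move=> mA mC; have [A0|A0] := eqVneq (pr A) 0; last by rewrite mulrCA mulfV ?mulr1.
have mCA : measurable (C `&` A) by exact: measurableI.
rewrite A0 mul0r; apply/eqP; rewrite eq_le pr_ge0 -A0.
exact: pr_le.
Qed.

(** Total expectation over the outcome of [X i.+1]; the summand 1 is the hit just revealed. Null
    pieces are covered by [prMdiv]. *)
Let cmean_split (A : set T) (i r : nat) : measurable A ->
  pr A * cmean A i r.+1 =
  pr (A `&` X i.+1 @^-1` B) * (1 + cmean (A `&` X i.+1 @^-1` B) i.+1 r) +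
  pr (A `&` ~` (X i.+1 @^-1` B)) * cmean (A `&` ~` (X i.+1 @^-1` B)) i.+1 r.
Proof.
move=> mA; have mA1 : measurable (A `&` X i.+1 @^-1` B) by exact: measurableI.
have mA0 : measurable (A `&` ~` (X i.+1 @^-1` B)).
  by apply: measurableI => //; exact: measurableC.
rewrite /cmean big_ord_recl/= addn0 mulrDr prMdiv// mulrDr mulr1 -addrA.
rewrite [in LHS]setIC; congr +%R.
rewrite !mulr_sumr -big_split/=; apply: eq_bigr => k _.
rewrite /bump/= add1n addnS -addSn !prMdiv// !setIA -prI//.
exact: measurableI.
Qed.

Variables (K lam : R).
Hypothesis K_ge : forall r : nat, 1 + 2 * \sum_(k < r) phi_mix P X k.+1 <= K.
Hypotheses (lam_ge0 : 0 <= lam) (lamK : lam * K <= 2^-1).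

Let count (i r : nat) (w : T) : R := \sum_(k < r) \1_B (X (i + k).+1 w).

Let mcount i r (t : R) : measurable [set w | t <= count i r w].
Proof.
have -> : [set w | t <= count i r w] = setT `&` (count i r) @^-1` `[t, +oo[.
  by rewrite setTI; apply/seteqP; split => w/=; rewrite in_itv/= andbT.
suff : measurable_fun setT (count i r) by apply => //.
apply: measurable_sum => k; apply: (measurableT_comp _ (mX _)).
exact: measurable_indic.
Qed.

Let count_split i r (t : R) (A : set T) :
  (A `&` [set w | t <= count i r.+1 w]) `&` X i.+1 @^-1` B =
  (A `&` X i.+1 @^-1` B) `&` [set w | t - 1 <= count i.+1 r w] /\
  (A `&` [set w | t <= count i r.+1 w]) `&` ~` (X i.+1 @^-1` B) =
  (A `&` ~` (X i.+1 @^-1` B)) `&` [set w | t <= count i.+1 r w].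
Proof.
have cE w : count i r.+1 w = \1_B (X i.+1 w) + count i.+1 r w.
  rewrite /count big_ord_recl/= addn0; congr +%R.
  by apply: eq_bigr => k _; rewrite /bump/= add1n addnS -addSn.
split; rewrite setIAC; apply/seteqP; split => w [[Aw Bw]]/=; rewrite cE indicE.
- by rewrite mem_set// lerBlDl.
- by rewrite mem_set// lerBlDl.
- by rewrite memNset// add0r.
- by rewrite memNset// add0r.
Qed.

(* A Hoeffding-Azuma bound without conditional expectations: the events A run
   over the atoms of the past, and splitting A along the next variable changes
   the conditional mean of the remaining count by at most K. *)
Let tail_cond r : forall i A (t : R), sigmaF X 1 i A ->
  pr (A `&` [set w | t <= count i r w]) <=
  pr A * expR (lam * (cmean A i r - t) + 2 * (lam * K) ^+ 2 * r%:R).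
Proof.
elim: r => [|r IH] i A t FA; have mA := gen_sigma_measurable FA.
  have mC : measurable (A `&` [set w | t <= count i 0 w]) by exact: measurableI.
  have [t0|t0] := leP t 0.
    apply: (@le_trans _ _ (pr A)); first exact: pr_le.
    rewrite ler_peMr// /cmean big_ord0 sub0r mulr0 addr0 -expR0 ler_expR.
    by rewrite mulr_ge0// oppr_ge0.
  rewrite (_ : [set w | _] = set0) ?setI0/pr ?measure0.
    by rewrite mulr_ge0 ?expR_ge0//; exact: pr_ge0.
  rewrite -subset0 => w/=; rewrite /count big_ord0 leNgt t0.
  by [].
set Bi := X i.+1 @^-1` B; set A1 := A `&` Bi; set A0 := A `&` ~` Bi.
have mBi : measurable Bi by exact: mXB.
have FBi (C : set R) : measurable C -> sigmaF X 1 i.+1 (X i.+1 @^-1` C).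
  by move=> mC; apply: gen_sigma_preimage => //=; rewrite leqnn.
have FA' : sigmaF X 1 i.+1 A.
  apply: gen_sigmaS FA => j/= /andP[-> /leqW ->]; exact: isT.
have FA1 : sigmaF X 1 i.+1 A1 by apply: gen_sigmaI => //; exact: FBi.
have FA0 : sigmaF X 1 i.+1 A0.
  by apply: gen_sigmaI => //; apply: (FBi (~` B)); exact: measurableC.
have [cs1 cs0] := count_split i r t A.
rewrite (@prI _ Bi) ?cs1 ?cs0//; last exact: measurableI.
apply: le_trans (lerD (IH _ _ _ FA1) (IH _ _ _ FA0)) _.
have := cmean_split i r mA; rewrite -/Bi -/A1 -/A0.
have PA : pr A = pr A1 + pr A0 by exact: prI.
set m := cmean A i r.+1; set u := cmean A1 _ _; set v := cmean A0 _ _ => PAm.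
set c := 2 * (lam * K) ^+ 2.
have c0 : 0 <= c by rewrite /c mulr_ge0 ?sqr_ge0.
have a1 := pr_ge0 A1; have a0 := pr_ge0 A0.
have [PA0|PA0] := eqVneq (pr A) 0.
  have [z1 z0] : pr A1 = 0 /\ pr A0 = 0 by split; lra.
  by rewrite PA0 z1 z0 !mul0r addr0.
have PAp : 0 < pr A by rewrite lt_def PA0 pr_ge0.
(* All three exponents share the part [s]; once it is factored out, what remains is the two-point
   inequality with values [1 + u] and [v]. *)
have -> : lam * (u - (t - 1)) + c * r%:R = (c * r%:R - lam * t) + lam * (1 + u).
  by ring.
have -> : lam * (v - t) + c * r%:R = (c * r%:R - lam * t) + lam * v by ring.
have -> : lam * (m - t) + c * r.+1%:R = (c * r%:R - lam * t) + (lam * m + c).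
  by rewrite -natr1; ring.
set s := c * r%:R - lam * t.
rewrite !(expRD s) !(mulrCA _ (expR s)) -mulrDr ler_wpM2l ?expR_ge0//.
have mE : m = (pr A1 / pr A) * (1 + u) + (1 - pr A1 / pr A) * v.
  apply: (mulfI PA0); rewrite PAm.
  have -> : pr A0 = pr A - pr A1 by lra.
  by field.
pose q := pr A1 / pr A.
have q01 : 0 <= q <= 1.
  by rewrite /q divr_ge0//= ler_pdivrMr// mul1r PA lerDl.
have [E1 E0] : pr A1 = pr A * q /\ pr A0 = pr A * (1 - q).
  by split; rewrite /q; [field|rewrite PA; field; rewrite -PA].
have q0 : pr A1 = 0 -> q = 0 by move=> z; rewrite /q z mul0r.
have q1 : pr A0 = 0 -> q = 1.
  by move=> z; rewrite /q (_ : pr A1 = pr A) ?divff// PA z addr0.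
rewrite -/q in mE; clearbody q.
rewrite E1 E0 -!mulrA -mulrDr ler_wpM2l// mE.
(* On a null piece [cmean] carries no information and [cmean_dev] does not apply, but the weight [q]
   is then 0 or 1 and the piece drops out. *)
have [A1z|A1z] := eqVneq (pr A1) 0.
  by rewrite (q0 A1z) !mul0r !add0r subr0 !mul1r ler_expR lerDl.
have [A0z|A0z] := eqVneq (pr A0) 0.
  by rewrite (q1 A0z) subrr !mul0r !addr0 !mul1r ler_expR lerDl.
apply: two_point_mgf_le => //.
have A1p : 0 < pr A1 by rewrite lt_def A1z.
have A0p : 0 < pr A0 by rewrite lt_def A0z.
(* Both conditional means are close to the same unconditional mean, hence [1 + u] and [v] differ by
   at most 1 plus twice the sum of the coefficients. *)
have D1 := @cmean_dev _ i.+1 r isT FA1 A1p.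
have D0 := @cmean_dev _ i.+1 r isT FA0 A0p.
apply: le_trans (K_ge r); rewrite -/u -/v in D1 D0.
move: D1 D0; rewrite !ler_norml => /andP[? ?] /andP[? ?].
by apply/andP; split; lra.
Qed.

(** The conditional bound is started at time 0 from the whole space, where the conditional mean is
    [n%:R * q]. *)
Lemma phi_mixing_tail (n : nat) (q t : R) :
  (forall i, (1 <= i)%N -> P (X i @^-1` B) = q%:E) ->
  fine (P [set w | t <= \sum_(k < n) \1_B (X k.+1 w)]) <=
  expR (lam * (n%:R * q - t) + 2 * (lam * K) ^+ 2 * n%:R).
Proof.
move=> Pq.
have FT : sigmaF X 1 0 setT by exact: (@measurableT _ (g_sigma_algebraType _)).
have := @tail_cond n 0 setT t FT; rewrite setTI => /le_trans; apply.
rewrite /pr probability_setT mul1r /cmean.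
under eq_bigr do rewrite setIT /pr Pq//= probability_setT divr1.
by rewrite sumr_const card_ord -[q *+ n]mulr_natl.
Qed.

Lemma measurable_count_ge (n : nat) (t : R) :
  measurable [set w | t <= \sum_(k < n) \1_B (X k.+1 w)].
Proof. exact: (mcount 0). Qed.

End phi_mixing.

(** * The deviation rate *)

Section rate.
Context (R : realType).

Definition rate (n : nat) : R := Num.sqrt (ln n%:R / n%:R).

Lemma rate_ge0 n : 0 <= rate n.
Proof. exact: sqrtr_ge0. Qed.

Lemma sqr_rate n : (0 < n)%N -> n%:R * rate n ^+ 2 = ln n%:R.
Proof.
move=> n0; rewrite sqr_sqrtr ?divr_ge0 ?ln_ge0 ?ler1n//.
by rewrite mulrCA mulfV ?mulr1// pnatr_eq0 -lt0n.
Qed.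

Lemma ln_le_sqrt (x : R) : 0 < x -> ln x <= 2 * Num.sqrt x.
Proof.
move=> x0; have s0 : 0 < Num.sqrt x by rewrite sqrtr_gt0.
rewrite -{1}(sqr_sqrtr (ltW x0)) lnXn// -[ln _ *+ 2]mulr_natl ler_wpM2l//.
apply: (@le_trans _ _ (Num.sqrt x - 1)); last by lra.
by rewrite -{1}(subrKC 1 (Num.sqrt x)) le_ln1Dx//; lra.
Qed.

Lemma rate_lt (e : R) : 0 < e -> \forall n \near \oo, rate n < e.
Proof.
move=> e0; near=> n.
have n0 : 0 < n%:R :> R by near: n; exact: nbhs_infty_gtr.
have s0 : 0 < Num.sqrt n%:R :> R by rewrite sqrtr_gt0.
(* Beyond this threshold, [ln n <= 2 * sqrt n < e ^+ 2 * n]. *)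
have big : 2 / e ^+ 2 < Num.sqrt n%:R.
  have z : 0 <= 2 / e ^+ 2 by rewrite divr_ge0// exprn_ge0// ltW.
  rewrite -[ltLHS](ger0_norm z) -sqrtr_sqr ltr_sqrt//.
  by near: n; exact: nbhs_infty_gtr.
rewrite -[ltRHS](ger0_norm (ltW e0)) -sqrtr_sqr /rate.
rewrite ltr_sqrt ?exprn_gt0// ltr_pdivrMr//.
apply: le_lt_trans (ln_le_sqrt n0) _.
rewrite -{2}(sqr_sqrtr (ltW n0)) expr2 mulrA ltr_pM2r//.
by move: big; rewrite ltr_pdivrMr ?exprn_gt0// mulrC.
Unshelve. all: by end_near. Qed.

End rate.

(** * Borel-Cantelli for events of probability at most [n ^- 2] *)

Lemma sum_inv_sqr_le2 (R : realType) (n : nat) :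
  \sum_(k < n) (k.+1%:R ^- 2 : R) <= 2.
Proof.
(* The strengthened bound telescopes: [x ^- 2 <= 2 / x - 2 / (x + 1)] for [x >= 1]. *)
suff : \sum_(k < n) (k.+1%:R ^- 2 : R) <= 2 - 2 / n.+1%:R.
  by move/le_trans; apply; rewrite lerBlDr lerDl divr_ge0.
elim: n => [|n IH]; first by rewrite big_ord0 divr1 subrr.
rewrite big_ord_recr/=; apply: le_trans (lerD IH (lexx _)) _.
rewrite -[n.+2%:R]natr1; have : 1 <= n.+1%:R :> R by rewrite ler1n.
move: n.+1%:R => x x1.
have x0 : 0 < x by apply: lt_le_trans x1.
have x10 : 0 < x + 1 by rewrite addr_gt0.
rewrite -subr_ge0 (_ : _ - _ = (x - 1) / (x ^+ 2 * (x + 1))).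
  by rewrite divr_ge0 ?subr_ge0// mulr_ge0 ?exprn_ge0// ltW.
by field; rewrite !gt_eqF.
Qed.

Lemma borel_cantelli_inv_sqr (d : measure_display) (T : measurableType d)
    (R : realType) (P : probability T R) (E : nat -> set T) :
  (forall n, measurable (E n)) ->
  (\forall n \near \oo, fine (P (E n)) <= n%:R ^- 2) ->
  {ae P, forall w, \forall n \near \oo, ~ E n w}.
Proof.
(* The shift passes the threshold [N], so every [G k] obeys the bound; the extra 1 gives the
   comparison with [k.+1%:R ^- 2]. *)
move=> mE [N _ PE]; pose G n := E (n + N.+1)%N.
have mG n : measurable (G n) by exact: mE.
exists (lim_sup_set G); split.
- by apply: bigcapT_measurable => n; apply: bigcup_measurable.
- apply: lim_sup_set_cvg0 => //.
  apply: (@le_lt_trans _ _ (2%:E)); last exact: ltry.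
  apply: lime_le; first by apply: is_cvg_nneseries.
  apply: nearW => n; rewrite big_mkord.
  apply: (@le_trans _ _ ((\sum_(k < n) (k.+1%:R ^- 2 : R))%:E)); last first.
    by rewrite lee_fin sum_inv_sqr_le2.
  rewrite -sumEFin; apply: lee_sum => k _.
  rewrite -[leLHS]fineK ?fin_num_measure// lee_fin.
  apply: le_trans (PE _ _) _; first by rewrite /= addnS ltnW// ltnS leq_addl.
  rewrite lef_pV2 ?posrE ?exprn_gt0 ?ltr0n ?addnS//.
  by rewrite lerXn2r ?nnegrE// ler_nat ltnS leq_addr.
- move=> w/= nw n _; apply: contrapT => nE; apply: nw.
  exists (n + N.+1)%N => // m/= nm Em; apply: nE.
  by exists (m - N.+1)%N => /=; rewrite ?leq_subRL /G ?subnK// ?(leq_trans _ nm)// ?leq_addl// addnC.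
Qed.

(** * Empirical distribution function and its quantile *)

Section empirical.
Context (T : Type) (R : realType) (X : nat -> T -> R).

Lemma empF_indic n w x :
  empF X n w x = n%:R^-1 * \sum_(k < n) \1_(`]-oo, x]) (X k.+1 w).
Proof.
rewrite /empF big_add1/= big_mkord; congr *%R; apply: eq_bigr => k _.
rewrite indicE; case: ifPn => Xx.
  by rewrite mem_set//= in_itv.
by rewrite memNset//= in_itv/=; apply/negP.
Qed.

(** The tail bound controls only large counts; a lower bound on the count in []-oo, x]] is obtained
    as an upper bound on the complementary count. *)
Lemma sum_indic_gt n w x :
  \sum_(k < n) \1_(`]x, +oo[) (X k.+1 w) =
  n%:R - \sum_(k < n) \1_(`]-oo, x]) (X k.+1 w) :> R.
Proof.
apply/eqP; rewrite eq_sym subr_eq -big_split/= (eq_bigr (fun=> 1)).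
  by rewrite sumr_const card_ord.
move=> k _; rewrite !indicE; have [Xx|Xx] := leP (X k.+1 w) x.
  by rewrite memNset ?add0r ?mem_set//= in_itv//= andbT ltNge Xx.
by rewrite addrC memNset ?add0r ?mem_set//= in_itv//= ?andbT// leNgt Xx.
Qed.

Lemma empF_nondecreasing n w x y : x <= y -> empF X n w x <= empF X n w y.
Proof.
move=> xy; rewrite /empF ler_wpM2l ?invr_ge0//; apply: ler_sum => k _.
by case: ifPn => // Xx; rewrite ?(le_trans Xx xy)//; case: ifPn.
Qed.

Lemma normr_le_sum n w i : (1 <= i < n.+1)%N ->
  `|X i w| <= \sum_(1 <= j < n.+1) `|X j w|.
Proof.
move=> i1n; rewrite (bigD1_seq i) ?mem_index_iota ?iota_uniq//= lerDl.
exact: sumr_ge0.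
Qed.

Lemma empF_quantile_le n w p x : 0 < p ->
  p <= empF X n w x -> quantile (empF X n w) p <= x.
Proof.
move=> p0 px; apply: ge_inf => //.
(* Below this point no observation is counted, so the empirical function is 0, less than [p]. *)
exists (- \sum_(1 <= j < n.+1) `|X j w|) => y /= py; rewrite leNgt.
apply/negP => yM; move: py; rewrite leNgt => /negP; apply.
rewrite /empF big_nat_cond big1 ?mulr0// => i; rewrite andbT => i1n.
rewrite ifF//; apply/negbTE; rewrite -ltNge; apply: lt_le_trans yM _.
by rewrite lerNl; apply: le_trans (normr_le_sum w i1n); rewrite -normrN ler_norm.
Qed.

Lemma empF_quantile_ge n w p x : (0 < n)%N -> p <= 1 ->
  empF X n w x < p -> x <= quantile (empF X n w) p.
Proof.
move=> n0 p1 px; apply: lb_le_inf; last first.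
  move=> y/= py; rewrite leNgt; apply/negP => /ltW/(empF_nondecreasing n w).
  by apply/negP; rewrite -ltNge (lt_le_trans px).
(* At this point all observations are counted and the empirical function is 1; the level set is
   nonempty, so its [inf] is not a default value. *)
exists (\sum_(1 <= j < n.+1) `|X j w|) => /=.
rewrite /empF (eq_big_nat _ _ (F2 := fun=> 1)); last first.
  by move=> i i1n; rewrite (le_trans (ler_norm _) (normr_le_sum w i1n)).
rewrite sumr_const_nat subSS subn0 mulVf//.
by rewrite pnatr_eq0 -lt0n.
Qed.

End empirical.

(** * Almost sure bounds on counts in moving sets *)

Lemma phi_mixing_count_ae (d : measure_display) (T : measurableType d)
    (R : realType) (P : probability T R) (X : nat -> T -> R) (K : R)
    (B : nat -> set R) (q t : nat -> R) :
  (forall i, measurable_fun setT (X i)) ->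
  (forall r : nat, 1 + 2 * \sum_(k < r) phi_mix P X k.+1 <= K) ->
  (forall n, measurable (B n)) ->
  (forall n i, (1 <= i)%N -> P (X i @^-1` B n) = (q n)%:E) ->
  (\forall n \near \oo,
     n%:R * q n + (2 + 2 * K ^+ 2) * (n%:R * rate R n) <= t n) ->
  {ae P, forall w, \forall n \near \oo,
     \sum_(k < n) \1_(B n) (X k.+1 w) < t n}.
Proof.
move=> mX KP mB PB qt.
have K1 : 1 <= K by have := KP 0%N; rewrite big_ord0 mulr0 addr0.
pose E n := [set w | t n <= \sum_(k < n) \1_(B n) (X k.+1 w)].
suff : {ae P, forall w, \forall n \near \oo, ~ E n w}.
  apply: filterS => w; apply: filterS => n /= /negP.
  by rewrite -ltNge.
apply: borel_cantelli_inv_sqr => [n|]; first exact: measurable_count_ge.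
near=> n.
have n0 : (0 < n)%N by near: n; exists 1%N.
have lamK : rate R n * K <= 2^-1.
  rewrite -ler_pdivlMr ?(lt_le_trans ltr01)//; apply: ltW.
  near: n; apply: rate_lt.
  by rewrite divr_gt0// (lt_le_trans ltr01).
(* With [lam = rate R n] the linear term is at most [- (2 + 2 * K ^+ 2) * ln n] and the quadratic
   one is [2 * K ^+ 2 * ln n], which leaves [n ^- 2]. *)
apply: le_trans (phi_mixing_tail mX (mB n) KP (rate_ge0 R n) lamK n (t n) (PB n)) _.
have nln := sqr_rate R n0.
apply: (@le_trans _ _ (expR (- (2 * ln n%:R)))).
  rewrite ler_expR -nln.
  have : n%:R * q n + (2 + 2 * K ^+ 2) * (n%:R * rate R n) <= t n by near: n.
  move/(ler_wpM2l (rate_ge0 R n)); rewrite exprMn; nra.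
by rewrite expRN expRM_natl lnK ?posrE ?ltr0n.
Unshelve. all: by end_near. Qed.

(** * The distribution function near its quantile *)

Lemma cdf_reaches (d : measure_display) (T : measurableType d)
    (R : realType) (P : probability T R) (Y : T -> R) (F : R -> R) (p : R) :
  measurable_fun setT Y ->
  (forall x, P (Y @^-1` `]-oo, x]) = (F x)%:E) -> 0 < p < 1 ->
  [set x | p <= F x] !=set0 /\ has_lbound [set x | p <= F x].
Proof.
move=> mY PF /andP[p0 p1].
pose Y' : {RV P >-> R} := mfun_Sub (mem_set mY).
have FE x : cdf Y' x = (F x)%:E by rewrite -PF.
have Fnd x y : x <= y -> F x <= F y.
  by move=> xy; rewrite -lee_fin -!FE; exact: cdf_nondecreasing.
(* Failure of either claim keeps [F] on one side of [p], against its limit 1 at [+oo] or 0 at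
   [-oo]. *)
split; apply: contrapT => H.
- have : (1 <= p%:E)%E.
    rewrite -(cvg_lim _ (cvg_cdfy1 Y'))//.
    apply: lime_le; first by apply/cvg_ex; exists 1%E; exact: cvg_cdfy1.
    apply: nearW => x; rewrite FE lee_fin leNgt; apply/negP => /ltW px.
    by apply: H; exists x.
  by rewrite lee_fin leNgt p1.
- have : (p%:E <= 0)%E.
    rewrite -(cvg_lim _ (cvg_cdfNy0 Y'))//.
    apply: lime_ge; first by apply/cvg_ex; exists 0%E; exact: cvg_cdfNy0.
    apply: nearW => x; rewrite FE lee_fin leNgt; apply/negP => Fxp.
    apply: H; exists x => y /= py; rewrite leNgt; apply/negP => /ltW/Fnd.
    by apply/negP; rewrite -ltNge (lt_le_trans Fxp).
  by rewrite lee_fin leNgt p0.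
Qed.

Section density.
Context (R : realType) (F f : R -> R) (a e : R).
Hypothesis fc : forall x, `|x - a| < e -> 0 < f x /\ {for x, continuous f}.
Hypothesis Ff : forall x y, `|x - a| < e -> `|y - a| < e -> x <= y ->
  (F y - F x)%:E = (\int[lebesgue_measure]_(t in `[x, y]) (f t)%:E)%E.

Let near_itv x y t : `|x - a| < e -> `|y - a| < e -> x <= t <= y -> `|t - a| < e.
Proof.
rewrite !ltr_norml => /andP[x1 x2] /andP[y1 y2] /andP[xt ty].
by apply/andP; split; lra.
Qed.

Let mf x y : `|x - a| < e -> `|y - a| < e ->
  measurable_fun `[x, y] (fun t => (f t)%:E).
Proof.
move=> xe ye; apply/measurable_EFinP; apply: subspace_continuous_measurable_fun => //.
apply: continuous_in_subspaceT => t; rewrite inE/= in_itv/= => xty.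
by have [] := fc (near_itv xe ye xty).
Qed.

Let int_cst x y (c : R) : x <= y ->
  (\int[lebesgue_measure]_(t in `[x, y]) (cst c%:E t) = (c * (y - x))%:E)%E.
Proof.
move=> xy; rewrite integral_cst//= lebesgue_measure_itv/= lte_fin.
case: ltP => [_|yx]; first by rewrite -EFinD.
by rewrite (@le_anti _ _ x y) ?xy ?yx// subrr mulr0 mule0.
Qed.

Lemma cdf_increment_ge (c x y : R) : `|x - a| < e -> `|y - a| < e -> x <= y ->
  0 <= c -> (forall t, x <= t <= y -> c <= f t) -> c * (y - x) <= F y - F x.
Proof.
move=> xe ye xy c0 cf; rewrite -lee_fin Ff// -int_cst//.
by apply: ge0_le_integral => //; exact: mf.
Qed.

Lemma cdf_increment_le (c x y : R) : `|x - a| < e -> `|y - a| < e -> x <= y ->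
  (forall t, x <= t <= y -> f t <= c) -> F y - F x <= c * (y - x).
Proof.
move=> xe ye xy cf; rewrite -lee_fin Ff// -int_cst//.
apply: ge0_le_integral => //; last exact: mf.
move=> t/=; rewrite in_itv/= lee_fin => xty.
by have [/ltW] := fc (near_itv xe ye xty).
Qed.

End density.

(** [F (a - h) < p <= F (a + h)] for small [h > 0], and the increment bound lets [h] tend to 0 on
    both sides. *)
Lemma cdf_at_quantile (R : realType) (F : R -> R) (p e M : R) :
  let a := quantile F p in
  [set x | p <= F x] !=set0 -> has_lbound [set x | p <= F x] ->
  {homo F : x y / x <= y} -> 0 < e ->
  (forall x y, `|x - a| < e -> `|y - a| < e -> x <= y ->
     F y - F x <= M * (y - x)) ->
  F a = p.
Proof.
move=> a S0 Slb Fnd e0 FM.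
have ae : `|a - a| < e by rewrite subrr normr0.
(* [M] may be nonpositive, whereas the choice of [h] divides by the bound. *)
pose M' := Num.max M 1.
have M1 : 0 < M' by rewrite lt_max ltr01 orbT.
have MM : M <= M' by rewrite le_max lexx.
have small (eta : R) : 0 < eta -> exists2 h, 0 < h < e & M * h <= eta.
  move=> eta0; exists (Num.min (e / 2) (eta / M')).
    by rewrite lt_min !divr_gt0//= gt_min; apply/orP; left; lra.
  have hM : Num.min (e / 2) (eta / M') <= eta / M' by rewrite ge_min lexx orbT.
  have h0 : 0 <= Num.min (e / 2) (eta / M') by rewrite le_min !divr_ge0// ltW.
  apply: le_trans (ler_wpM2r h0 MM) _.
  by rewrite mulrC -ler_pdivlMr.
apply/eqP; rewrite eq_le; apply/andP; split.
  apply/ler_addgt0Pr => eta /small[h /andP[h0 he] Mh].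
  have h1 : `|a - h - a| < e by rewrite addrAC subrr sub0r normrN gtr0_norm.
  have := FM _ _ h1 ae; rewrite lerBlDr lerDl ltW// => /(_ isT).
  have : F (a - h) < p.
    rewrite ltNge; apply/negP => /(ge_inf Slb).
    by rewrite -/a leNgt ltrBlDr ltrDl h0.
  have -> : a - (a - h) = h by ring.
  lra.
apply/ler_addgt0Pr => eta /small[h /andP[h0 he] Mh].
have h1 : `|a + h - a| < e by rewrite addrAC subrr add0r gtr0_norm.
have := FM _ _ ae h1; rewrite lerDl ltW// => /(_ isT).
have : p <= F (a + h).
  have [y py yh] := inf_adherent h0 (conj S0 Slb).
  by apply: le_trans py (Fnd _ _ (ltW yh)).
have -> : a + h - a = h by ring.
lra.
Qed.

(** * Assembly of the four almost sure bounds *)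

Theorem theorem2p5 (d : measure_display) (T : measurableType d) (R : realType)
  (P : probability T R) (X : nat -> T -> R) (F : R -> R) (p : R)
  (f : R -> R) :
  (forall i, measurable_fun setT (X i)) ->
  (forall i x, (1 <= i)%N -> P (X i @^-1` `]-oo, x]) = (F x)%:E) ->
  (phi_mix P X n @[n --> \oo] --> 0) ->
  (\sum_(1 <= n <oo) (Num.sqrt (phi_mix P X n))%:E < +oo)%E ->
  0 < p < 1 ->
  (exists2 e : R, 0 < e &
     [/\ (forall x, `|x - quantile F p| < e -> 0 < f x /\ {for x, continuous f}),
         (forall x y, `|x - quantile F p| < e -> `|y - quantile F p| < e -> x <= y ->
             (F y - F x)%:E = (\int[lebesgue_measure]_(t in `[x, y]) (f t)%:E)%E),
         (exists M : R, forall x, `|x - quantile F p| < e -> f x <= M) &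
         0 < sup [set f x | x in [set x | `|x - quantile F p| < e]] ]) ->
  (exists2 e : R, 0 < e & exists M : R, forall x, `|x - quantile F p| < e ->
       derivable f x 1 /\ `|derive1 f x| <= M) ->
  {ae P, forall w, exists C : R, \forall n \near \oo,
      `| quantile (empF X n w) p
         - (quantile F p - (empF X n w (quantile F p) - p) / f (quantile F p)) |
      <= C * Num.sqrt (ln n%:R / n%:R)}.
Proof.
move=> mX PF _ Sphi p01 [e e0 [fc Ff [M fM] _]] _.
have [p0 p1] := andP p01.
set xi := quantile F p in fc Ff fM *.
have [S0 Slb] := cdf_reaches (mX 1%N) (fun x => PF 1%N x isT) p01.
have mXle i x : measurable (X i @^-1` `]-oo, x]).
  by rewrite -[_ @^-1` _]setTI; exact: mX.
have Fnd : {homo F : x y / x <= y}.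
  move=> x y xy; rewrite -lee_fin -!(PF 1%N)//.
  apply: le_measure; rewrite ?inE// => w/=; rewrite !in_itv/= => /le_trans; exact.
have itv_lt x y t : `|x - xi| < e -> `|y - xi| < e -> x <= t <= y -> `|t - xi| < e.
  rewrite !ltr_norml => /andP[? ?] /andP[? ?] /andP[? ?]; apply/andP; split; lra.
have Fxi : F xi = p.
  apply: (@cdf_at_quantile _ F p e M) => // x y xe ye xy.
  by apply: (cdf_increment_le fc Ff) => // t /(itv_lt _ _ _ xe ye); exact: fM.
have xie : `|xi - xi| < e by rewrite subrr normr0.
have [fxi0 cfxi] := fc _ xie.
(* By continuity [c] bounds [f] from below near [xi], so [F] grows there with slope at least [c]. *)
pose c := f xi / 2; have c0 : 0 < c by rewrite /c divr_gt0.
have [dl dl0 [dle dlf]] : exists2 dl, 0 < dl &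
    dl <= e /\ forall x, `|x - xi| < dl -> c <= f x.
  have /cvgrPdist_lt/(_ c c0)/nbhs_ballP[dl /= dl0 H] := cfxi.
  exists (Num.min dl e); first by rewrite lt_min dl0.
  split=> [|x]; first by rewrite ge_min lexx orbT.
  rewrite lt_min => /andP[xdl _].
  have : `|f xi - f x| < c by apply: H; rewrite /ball/= distrC.
  by rewrite ltr_norml /c => /andP[? ?]; lra.
have Fright h : 0 < h < dl -> p + c * h <= F (xi + h).
  move=> /andP[h0 hdl].
  have -> : c * h = c * (xi + h - xi) by ring.
  rewrite -lerBrDl -[p]Fxi.
  apply: (cdf_increment_ge fc Ff) => //; last 1 first.
  - move=> t /andP[t1 t2]; apply: dlf; rewrite ger0_norm; lra.
  - by rewrite addrAC subrr add0r gtr0_norm// (lt_le_trans hdl).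
  - by rewrite lerDl ltW.
  - exact: ltW.
have Fleft h : 0 < h < dl -> F (xi - h) <= p - c * h.
  move=> /andP[h0 hdl].
  have -> : c * h = c * (xi - (xi - h)) by ring.
  rewrite lerBrDl -lerBrDr -[p]Fxi.
  apply: (cdf_increment_ge fc Ff) => //; last 1 first.
  - move=> t /andP[t1 t2]; apply: dlf; rewrite ler0_norm; lra.
  - by rewrite addrAC subrr sub0r normrN gtr0_norm// (lt_le_trans hdl).
  - by rewrite lerBlDr lerDl ltW.
  - exact: ltW.
have [S SP] := sum_phi_mix_bounded mX Sphi.
pose K := 1 + 2 * S.
have KP r : 1 + 2 * \sum_(k < r) phi_mix P X k.+1 <= K.
  by rewrite lerD2l ler_wpM2l.
pose C := 2 + 2 * K ^+ 2; have C0 : 0 < C.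
  by rewrite ltr_wpDr// mulr_ge0// sqr_ge0.
(* A move of [D * rate R n] away from [xi] changes [F] by at least [C * rate R n], the margin
   required by [phi_mixing_count_ae]. *)
pose D := C / c; have D0 : 0 < D by rewrite divr_gt0.
have PFgt i x : (1 <= i)%N -> P (X i @^-1` `]x, +oo[) = (1 - F x)%:E.
  move=> i1; have -> : X i @^-1` `]x, +oo[ = ~` (X i @^-1` `]-oo, x]).
    by rewrite preimage_setC setCitvl.
  by rewrite probability_setC ?PF.
have cD : c * D = C by rewrite /D mulrC divfK// gt_eqF.
have hP : \forall n \near \oo, 0 < D * rate R n < dl.
  near=> n; apply/andP; split.
    (* [rate] vanishes at [n = 1], and the step must be positive. *)
    have n1 : (1 < n)%N by near: n; exists 2%N.
    rewrite mulr_gt0// sqrtr_gt0 divr_gt0 ?ln_gt0 ?ltr1n// ltr0n.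
    exact: ltnW.
  rewrite mulrC -ltr_pdivlMr//; near: n; apply: rate_lt.
  by rewrite divr_gt0.
(* [ae1] and [ae2] trap the empirical quantile within [D * rate R n] of [xi]; [ae3] and [ae4] bound
   the empirical deviation at [xi] from both sides. *)
have ae1 := @phi_mixing_count_ae _ _ _ P X K
  (fun n => `]xi + D * rate R n, +oo[%classic)
  (fun n => 1 - F (xi + D * rate R n)) (fun n => n%:R * (1 - p)) mX KP
  (fun=> measurable_itv _) (fun n i => PFgt i _).
have ae2 := @phi_mixing_count_ae _ _ _ P X K
  (fun n => `]-oo, xi - D * rate R n]%classic)
  (fun n => F (xi - D * rate R n)) (fun n => n%:R * p) mX KP
  (fun=> measurable_itv _) (fun n i => PF i _).
have ae3 := @phi_mixing_count_ae _ _ _ P X K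
  (fun n => `]xi, +oo[%classic)
  (fun n => 1 - F xi) (fun n => n%:R * (1 - p) + C * (n%:R * rate R n)) mX KP
  (fun=> measurable_itv _) (fun n i => PFgt i _).
have ae4 := @phi_mixing_count_ae _ _ _ P X K
  (fun n => `]-oo, xi]%classic)
  (fun n => F xi) (fun n => n%:R * p + C * (n%:R * rate R n)) mX KP
  (fun=> measurable_itv _) (fun n i => PF i _).
have b1 : \forall n \near \oo, n%:R * (1 - F (xi + D * rate R n)) +
    (2 + 2 * K ^+ 2) * (n%:R * rate R n) <= n%:R * (1 - p).
  apply: filterS hP => n /Fright; rewrite mulrA cD => H.
  rewrite mulrCA -mulrDr ler_wpM2l// -/C; lra.
have b2 : \forall n \near \oo, n%:R * F (xi - D * rate R n) +
    (2 + 2 * K ^+ 2) * (n%:R * rate R n) <= n%:R * p.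
  apply: filterS hP => n /Fleft; rewrite mulrA cD => H.
  rewrite mulrCA -mulrDr ler_wpM2l// -/C; lra.
have b3 : \forall n \near \oo, n%:R * (1 - F xi) +
    (2 + 2 * K ^+ 2) * (n%:R * rate R n) <=
    n%:R * (1 - p) + C * (n%:R * rate R n).
  by apply: nearW => n; rewrite Fxi.
have b4 : \forall n \near \oo, n%:R * F xi +
    (2 + 2 * K ^+ 2) * (n%:R * rate R n) <= n%:R * p + C * (n%:R * rate R n).
  by apply: nearW => n; rewrite Fxi.
apply: filterS (filterI (filterI (ae1 b1) (ae2 b2)) (filterI (ae3 b3) (ae4 b4))).
move=> w [[/= h1 h2] [/= h3 h4]].
(* [D] pays for the quantile deviation, [C / f xi] for the empirical deviation divided by the
   density. *)
exists (D + C / f xi); near=> n.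
have n0 : (0 < n)%N by near: n; exists 1%N.
have nR : 0 < n%:R :> R by rewrite ltr0n.
have g1 : \sum_(k < n) \1_(`]xi + D * rate R n, +oo[) (X k.+1 w) <
  n%:R * (1 - p) by near: n.
have g2 : \sum_(k < n) \1_(`]-oo, xi - D * rate R n]) (X k.+1 w) <
  n%:R * p by near: n.
have g3 : \sum_(k < n) \1_(`]xi, +oo[) (X k.+1 w) <
  n%:R * (1 - p) + C * (n%:R * rate R n) by near: n.
have g4 : \sum_(k < n) \1_(`]-oo, xi]) (X k.+1 w) <
  n%:R * p + C * (n%:R * rate R n) by near: n.
have nE x : n%:R * empF X n w x = \sum_(k < n) \1_(`]-oo, x]) (X k.+1 w).
  by rewrite empF_indic mulrA divff ?mul1r// gt_eqF.
rewrite -!nE in g2 g4; rewrite !sum_indic_gt -!nE in g1 g3.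
have q1 : quantile (empF X n w) p <= xi + D * rate R n.
  by apply: empF_quantile_le => //; rewrite -(ler_pM2l nR); lra.
have q2 : xi - D * rate R n <= quantile (empF X n w) p.
  by apply: empF_quantile_ge; rewrite ?ltW// -(ltr_pM2l nR).
have q3 : `|empF X n w xi - p| <= C * rate R n.
  by rewrite ler_norml; apply/andP; split; rewrite -(ler_pM2l nR); lra.
rewrite -/(rate R n) opprB addrCA [leRHS]mulrDl; apply: le_trans (ler_normD _ _) _.
rewrite [leLHS]addrC lerD//; last first.
  rewrite normrM normfV (gtr0_norm fxi0) mulrAC ler_wpM2r//.
  by rewrite invr_ge0 ltW.
by rewrite ler_norml; apply/andP; split; lra.
Unshelve. all: by end_near. Qed.
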